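(* Let $q=p^d$, where $p$ is an odd prime and $d\ge 1$ is an integer. Let $M_q$ be the number of $\alpha\in\mathbb{F}_q$ such that $\alpha-1,\alpha,\alpha+1$ are all non-zero squares in $\mathbb{F}_q$, and let $N_q$ be the number of $\alpha\in\mathbb{F}_q$ such that $\alpha-1,\alpha,\alpha+1$ are all non-squares in $\mathbb{F}_q$. Case 1. If $q\equiv 7 \pmod 8$, then $$M_q=N_q=\frac{q-7}{8}.$$ Case 2. If $q\equiv 3 \pmod 8$, then $$M_q=N_q=\frac{q-3}{8}.$$ Case 3. If $q\equiv 5\pmod 8$, then $$M_q=\frac{q+2s-7}{8},\qquad N_q=\frac{q-2s-3}{8},$$ where $s$ is the integer uniquely determined by the conditions that $q=s^2+t^2$ for some integer $t$, $p\nmid s$, and $s\equiv 1\pmod 4$. Case 4. If $q=p^d\equiv 1\pmod 8$, where $p\equiv 1\pmod 4$, then $$M_q=\frac{q-2s-15}{8},\qquad N_q=\frac{q+2s-3}{8},$$ where $s$ is the integer uniquely determined by the conditions that $q=s^2+t^2$ for some integer $t$, $p\nmid s$, and $s\equiv 1\pmod 4$. Case 5. If $q=p^d\equiv 1\pmod 8$, where $p\equiv 3\pmod 4$, then $q$ is a square and $$M_q=\frac18\left(q-2(-1)^{d/2}\sqrt{q}-15\right),\qquad N_q=\frac18\left(q+2(-1)^{d/2}\sqrt{q}-3\right).$$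
   Context: $\mathbb{F}_q$ denotes the finite field of order $q$. A non-zero square is an element of the form $\beta^2$ with $\beta\in\mathbb{F}_q$, $\beta\neq 0$; a non-square is an element of $\mathbb{F}_q$ that is not of the form $\beta^2$ with $\beta\in\mathbb{F}_q$ (so $0$ is neither a non-zero square nor a non-square). *)

(* Defs.v *)
From HB Require Import structures.
From mathcomp Require Import all_boot all_order all_algebra all_field.

Set Implicit Arguments.
Unset Strict Implicit.
Unset Printing Implicit Defensive.

Import Order.TTheory GRing.Theory Num.Theory.
Local Open Scope ring_scope.

Definition nonzero_square (F : finFieldType) (x : F) : bool :=
  [exists b : F, (b != 0) && (x == b ^+ 2)].

Definition nonsquare (F : finFieldType) (x : F) : bool :=
  ~~ [exists b : F, x == b ^+ 2].

Definition Mcount (F : finFieldType) : nat :=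
  #|[set a : F | [&& nonzero_square (a - 1), nonzero_square a
                   & nonzero_square (a + 1)]]|.

Definition Ncount (F : finFieldType) : nat :=
  #|[set a : F | [&& nonsquare (a - 1), nonsquare a & nonsquare (a + 1)]]|.

Definition two_squares_part (p q : nat) (s : int) : Prop :=
  [/\ exists t : int, q%:Z = s ^+ 2 + t ^+ 2,
      ~~ (p%:Z %| s)%Z
    & (s = 1 %[mod 4])%Z].

(* Main.v *)
Require Import Defs.
From HB Require Import structures.
From mathcomp Require Import all_boot all_order all_algebra all_field.
From mathcomp Require Import cyclic zify ring.

Set Implicit Arguments.
Unset Strict Implicit.
Unset Printing Implicit Defensive.

Import Order.TTheory GRing.Theory Num.Theory.
Local Open Scope ring_scope.

(** Let chi be the quadratic character of F and e = 1 or -1.  For a other than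
    0, 1 and -1 the product
      (1 + e chi(a - 1)) (1 + e chi(a)) (1 + e chi(a + 1))
    is 8 when the three characters all equal e, and 0 otherwise.  Summing its
    expansion over F turns both counts into character sums: the linear terms
    vanish, each quadratic term contributes -1, and the cubic term is e S with
    S = sum of chi(x (x^2 - 1)).  The excluded values of a give corrections
    that depend only on chi(-1) and chi(2) ([card_triples]).

    When q = 3 mod 4, S = 0 because x -> -x changes the sign of the summand.
    When q = 1 mod 4, put S(a) = sum of chi(x (x^2 - a)).  Scaling x shows that
    S(a)^2 depends only on chi(a), and computing the sum of all the S(a)^2
    gives S(1)^2 + S(g)^2 = 4 q for any non-square g
    ([cubic_sum_two_squares]); both sums are even, so q = s^2 + t^2 with
    S(1) = 2 s up to sign.

    All remaining data come from the fact that the counts are integers.  For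
    q = 3 mod 4 divisibility by 8 yields chi(2).  For q = 1 mod 4 both counts
    are even, since a -> -a permutes the triples freely; hence divisibility by
    16, which yields chi(2).  Then divisibility by 8 fixes s mod 4, so the
    sign of S(1).

    If p = 1 mod 4, Euler's criterion evaluates S(1) in F as a single binomial
    coefficient up to sign, which p does not divide ([cubic_sum_modp],
    [ndvdn_bin_half]); so p does not divide s, and s is the only integer with
    the required properties ([two_squares_unique]).  If p = 3 mod 4 and d is
    even, -1 is not a square mod p, so infinite descent forces one of s, t to
    be 0 ([two_squares_3mod4]); as s is odd, s is p^(d/2) up to sign, and its
    residue mod 4 gives the sign. *)

(** * The quadratic character *)

Definition quad_char (F : finFieldType) (x : F) : int :=
  if x == 0 then 0 else if nonsquare x then -1 else 1.

Section QuadraticCharacter.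

Variable F : finFieldType.
Hypothesis oddF : odd #|F|.

Local Notation chi := (@quad_char F).
Local Notation m := (#|F|./2).

Lemma card_odd : #|F| = m.*2.+1.
Proof. by rewrite -[LHS](odd_double_half #|F|) oddF. Qed.

Lemma card_half_gt0 : (0 < m)%N.
Proof. by have := finNzRing_gt1 F; rewrite [X in (_ < X)%N]card_odd; lia. Qed.

Lemma unit_expr x : x != 0 :> F -> x ^+ m.*2 = 1.
Proof.
move=> x0; apply: (mulfI x0); rewrite -exprS -card_odd mulr1; exact: expf_card.
Qed.

Lemma exists_generator : exists z : F, m.*2.-primitive_root z.
Proof.
have /hasP[z _ ?] : has m.*2.-primitive_root (enum (predC1 (0 : F))).
  apply: has_prim_root; rewrite ?enum_uniq //.
  - by rewrite double_gt0 card_half_gt0.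
  - apply/allP => x; rewrite mem_enum !inE => x0; rewrite unity_rootE.
    by rewrite unit_expr.
  - by rewrite -cardE cardC1 [X in (_ <= X.-1)%N]card_odd.
by exists z.
Qed.

Lemma generator_half z : m.*2.-primitive_root z -> z ^+ m = -1 :> F.
Proof.
move=> pz; have : (z ^+ m) ^+ 2 == 1.
  by rewrite -exprM muln2 prim_expr_order.
rewrite sqrf_eq1 => /orP[|/eqP//].
rewrite -(prim_order_dvd pz) => /dvdn_leq; have := card_half_gt0; lia.
Qed.

Lemma generator_neq0 z : m.*2.-primitive_root z -> z != 0 :> F.
Proof.
move=> pz; apply: contra_eq_neq (generator_half pz) => ->.
by rewrite expr0n gtn_eqF ?card_half_gt0 // eq_sym oppr_eq0 oner_eq0.
Qed.

Lemma generator_log z x : m.*2.-primitive_root z -> x != 0 :> F ->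
  exists i, x = z ^+ i.
Proof. by move=> pz x0; have [i ->] := prim_rootP pz (unit_expr x0); exists i. Qed.

Lemma oneN1 : -1 != 1 :> F.
Proof.
have [z pz] := exists_generator; rewrite -(generator_half pz).
rewrite -(prim_order_dvd pz); apply/negP => /dvdn_leq; have := card_half_gt0; lia.
Qed.

Lemma two_neq0 : 2 != 0 :> F.
Proof. by have := oneN1; rewrite eq_sym -subr_eq0 opprK. Qed.

(** Reading chi on exponents of a generator makes multiplicativity, the value
    at -1 and Euler's criterion immediate. *)
Lemma chi_generator z i : m.*2.-primitive_root z -> chi (z ^+ i) = (-1) ^+ i.
Proof.
move=> pz; have z0 := generator_neq0 pz.
rewrite /quad_char expf_eq0 (negPf z0) andbF /nonsquare.
case: existsP => [[b /eqP bE]|nb] /=.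
  have b0 : b != 0 by apply: contraNneq z0 => b0; move: bE; rewrite b0 expr0n /= => /eqP; rewrite expf_eq0 => /andP[].
  have [j bj] := generator_log pz b0.
  move/eqP: bE; rewrite bj -exprM (eq_prim_root_expr pz) => /eqP/(congr1 odd).
  by rewrite -signr_odd !odd_mod ?odd_double // oddM andbF => ->.
have oi : odd i.
  apply/negPn/negP => ei; apply: nb; exists (z ^+ i./2).
  by rewrite -exprM muln2 even_halfK.
by rewrite -signr_odd oi.
Qed.

Lemma chi0 : chi 0 = 0. Proof. by rewrite /quad_char eqxx. Qed.

Lemma chiM x y : chi (x * y) = chi x * chi y.
Proof.
have [->|x0] := eqVneq x 0; first by rewrite mul0r chi0 mul0r.
have [->|y0] := eqVneq y 0; first by rewrite mulr0 chi0 mulr0.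
have [z pz] := exists_generator.
have [i ->] := generator_log pz x0; have [j ->] := generator_log pz y0.
by rewrite -exprD !chi_generator // exprD.
Qed.

Lemma chi_sign x : x != 0 -> (chi x == 1) || (chi x == -1).
Proof. by rewrite /quad_char => /negPf->; case: ifP. Qed.

Lemma chi_sqr x : x != 0 -> chi x ^+ 2 = 1.
Proof. by case/chi_sign/orP => /eqP->. Qed.

Lemma chi1 : chi 1 = 1.
Proof. by have [z pz] := exists_generator; rewrite -(expr0 z) chi_generator. Qed.

Lemma chiN1 : chi (-1) = (-1) ^+ m.
Proof.
by have [z pz] := exists_generator; rewrite -(generator_half pz) chi_generator.
Qed.

Lemma chiN x : chi (- x) = (-1) ^+ m * chi x.
Proof. by rewrite -[- x]mulN1r chiM chiN1. Qed.

Lemma euler_criterion x : (chi x)%:~R = x ^+ m.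
Proof.
have [->|x0] := eqVneq x 0; first by rewrite chi0 expr0n gtn_eqF ?card_half_gt0.
have [z pz] := exists_generator; have [i ->] := generator_log pz x0.
by rewrite chi_generator // exprAC generator_half // rmorphXn rmorphN1.
Qed.

Lemma exists_nonsquare : exists g, chi g = -1.
Proof.
by have [z pz] := exists_generator; exists z; rewrite -[z]expr1 chi_generator.
Qed.

(** Multiplication by a non-square permutes F and negates the sum. *)
Lemma sum_chi : \sum_x chi x = 0.
Proof.
have [g chig] := exists_nonsquare.
have g0 : g != 0 by apply: contra_eq_neq chig => ->; rewrite chi0.
have : \sum_x chi x = - \sum_x chi x.
  rewrite {1}(reindex_inj (mulfI g0)) /= -sumrN.
  by apply: eq_bigr => x _; rewrite chiM chig mulN1r.
lia.
Qed.

Lemma sum_chi_shift a : \sum_x chi (x - a) = 0.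
Proof.
by have := sum_chi; rewrite (reindex_inj (addIr (- a))).
Qed.

(** Shift so that the roots are 0 and b - a.  For x nonzero, dividing by the
    square x^2 and inverting x leaves the values chi(1 - (b - a) x), which are
    those of chi on F without the value at 1. *)
Lemma sum_chi_quadratic a b : a != b -> \sum_x chi ((x - a) * (x - b)) = -1.
Proof.
move=> ab; have c0 : b - a != 0 by rewrite subr_eq0 eq_sym.
rewrite (reindex_inj (addIr a)) /= (bigD1 0) //= add0r subrr mul0r chi0 add0r.
transitivity (\sum_(x | x != 0) chi (1 - (b - a) * x)).
  rewrite (reindex_onto GRing.inv GRing.inv) /=; last by move=> x; rewrite invrK.
  apply: eq_big => [x|x x0]; first by rewrite invr_eq0 invrK eqxx andbT.
  move: x0; rewrite invr_eq0 invrK eqxx andbT => x0.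
  have -> : (x^-1 + a - a) * (x^-1 + a - b) = x^-1 ^+ 2 * (1 - (b - a) * x) by field.
  by rewrite chiM [chi (_ ^+ 2)]chiM -expr2 chi_sqr ?mul1r // invr_eq0.
have := sum_chi; rewrite (reindex_inj (can_inj (subKr 1))) /=.
rewrite (reindex_inj (mulfI c0)) /= (bigD1 0) //= mulr0 subr0 chi1.
by move/eqP; rewrite addrC addr_eq0 => /eqP.
Qed.

End QuadraticCharacter.

(** * Triples of equal quadratic character *)

Lemma even_card_involution (T : finType) (f : T -> T) (A : {set T}) :
  involutive f -> {in A, forall x, f x \in A} -> {in A, forall x, f x != x} ->
  ~~ odd #|A|.
Proof.
(* B picks one element from each orbit {x, f x} *)
move=> fK fA fx; pose B := [set x | (enum_rank x < enum_rank (f x))%N].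
have -> : #|A| = (#|A :&: B|).*2; last by rewrite odd_double.
rewrite -addnn -{1}(cardsID B A); congr (_ + _)%N.
rewrite -[RHS](card_imset _ (can_inj fK)); apply: eq_card => x.
apply/idP/imsetP => [|[y]]; rewrite !inE -?leqNgt.
  case/andP=> xB xA; exists (f x); last by rewrite fK.
  rewrite !inE fA // fK ltn_neqAle xB andbT.
  by apply: contra (fx x xA) => /eqP/val_inj/enum_rank_inj/eqP.
by case/andP=> yA yB ->; rewrite fK fA // (ltnW yB).
Qed.

(** Up to sign, the trace of Frobenius of the curve y^2 = x^3 - a x. *)
Definition cubic_sum (F : finFieldType) (a : F) : int :=
  \sum_x quad_char (x * (x ^+ 2 - a)).

Section Triples.

Variable F : finFieldType.
Hypothesis oddF : odd #|F|.

Local Notation chi := (@quad_char F).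
Local Notation m := (#|F|./2).
Local Notation S := (cubic_sum (1 : F)).

Definition triples (e : int) : {set F} :=
  [set a : F | [&& chi (a - 1) == e, chi a == e & chi (a + 1) == e]].

Lemma nonzero_squareE (x : F) : nonzero_square x = (chi x == 1).
Proof.
rewrite /quad_char; have [->|x0] := eqVneq x 0.
  apply/negbTE/existsP => -[b /andP[b0]].
  by rewrite eq_sym expf_eq0 /= (negPf b0).
rewrite /nonsquare if_neg; case: existsP => [[b /eqP xE]|nb].
  rewrite eqxx; apply/existsP; exists b; rewrite xE eqxx andbT.
  by apply: contra_neq x0 => b0; rewrite xE b0 expr0n.
by apply/negbTE/existsP => -[b /andP[_ xb]]; apply: nb; exists b.
Qed.

Lemma nonsquareE (x : F) : nonsquare x = (chi x == -1).
Proof.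
rewrite /quad_char; have [->|x0] := eqVneq x 0; last by case: ifP.
by apply/negP; apply; apply/existsP; exists 0; rewrite expr0n.
Qed.

Lemma McountE : Mcount F = #|triples 1|.
Proof. by apply: eq_card => a; rewrite !inE !nonzero_squareE. Qed.

Lemma NcountE : Ncount F = #|triples (-1)|.
Proof. by apply: eq_card => a; rewrite !inE !nonsquareE. Qed.

Lemma sum_triple_product (e : int) : e ^+ 2 = 1 ->
  \sum_x (1 + e * chi (x - 1)) * (1 + e * chi x) * (1 + e * chi (x + 1)) =
    #|F|%:R - 3 + e * S.
Proof.
move=> e2.
transitivity (\sum_x (1 + (e * chi (x - 1) + (e * chi (x - 0) +
    (e * chi (x - - 1) + (chi ((x - 1) * (x - 0)) + (chi ((x - 0) * (x - - 1)) +
    (chi ((x - 1) * (x - - 1)) + e * chi (x * (x ^+ 2 - 1)))))))))).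
  apply: eq_bigr => x _.
  have -> : x ^+ 2 - 1 = (x - 1) * (x + 1) by ring.
  rewrite !(opprK, subr0, chiM) //; have := e2.
  move/eqP; rewrite sqrf_eq1 => /orP[]/eqP->; ring.
rewrite !big_split /= -!mulr_sumr !sum_chi_shift // !sum_chi_quadratic //.
- by rewrite sumr_const /cubic_sum; ring.
- by rewrite eq_sym oneN1.
- by rewrite eq_sym oppr_eq0 oner_neq0.
- exact: oner_neq0.
Qed.

(** The subtracted terms are the values of the product at 0, 1 and -1, where a
    factor has character 0 and the product does not detect triples. *)
Lemma card_triples (e : int) : e ^+ 2 = 1 ->
  8 * #|triples e|%:R = #|F|%:R - 3 + e * S
    - ((1 + e * chi (-1)) * (1 + e) + (1 + e) * (1 + e * chi 2)
       + (1 + e * chi (-2)) * (1 + e * chi (-1))).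
Proof.
move=> e2; rewrite -sum_triple_product //.
have e1 : (e == 1) || (e == -1) by rewrite -sqrf_eq1 e2.
have n10 : (1 : F) != 0 := oner_neq0 F.
have n11 : (-1 : F) != 1 := oneN1 oddF.
have n01 : (-1 : F) != 0 by rewrite oppr_eq0.
set f := fun x : F => (1 + e * chi (x - 1)) * (1 + e * chi x) * (1 + e * chi (x + 1)).
rewrite -[X in X - _]/(\sum_x f x) (bigD1 0) // (bigD1 1) //= (bigD1 (-1)) /=; last by rewrite n01.
have -> : f 0 = (1 + e * chi (-1)) * (1 + e).
  by rewrite /f sub0r add0r chi0 chi1 // mulr0 addr0 !mulr1.
have -> : f 1 = (1 + e) * (1 + e * chi 2).
  by rewrite /f subrr chi0 chi1 // mulr0 addr0 mul1r mulr1.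
have -> : f (-1) = (1 + e * chi (-2)) * (1 + e * chi (-1)).
  by rewrite /f addNr chi0 -opprD mulr0 addr0 mulr1.
rewrite -sum1_card natr_sum big_mkcond /= (bigD1 0) // (bigD1 1) //= (bigD1 (-1)) /=; last by rewrite n01.
have en0 : (0 == e) = false by case/orP: e1 => /eqP->.
rewrite !inE !(subrr, addNr) chi0 en0 !(andbF, andFb) !add0r mulr_sumr.
rewrite (_ : forall a b c d : int, a + (b + (c + d)) - (a + b + c) = d); last by move=> *; ring.
apply: eq_bigr => x /andP[/andP[x0 x1] xN1]; rewrite inE /f.
have /(chi_sign) x1' : x - 1 != 0 by rewrite subr_eq0.
have /(chi_sign) x2' : x + 1 != 0 by rewrite addr_eq0.
move/chi_sign: x0.
by case/orP: x1' => /eqP->; case/orP: x2' => /eqP->; case/orP => /eqP->;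
  case/orP: e1 => /eqP->.
Qed.

Lemma cubic_sum_eq0 : odd m -> S = 0.
Proof.
move=> om; suff : S = - S by lia.
rewrite {1}/cubic_sum (reindex_inj oppr_inj) /= -sumrN; apply: eq_bigr => x _.
by rewrite sqrrN mulNr chiN // -signr_odd om mulN1r.
Qed.

(** When -1 is a square, a -> -a reverses a triple and preserves its characters;
    it fixes only 0, whose character is 0. *)
Lemma even_card_triples e : ~~ odd m -> e != 0 -> ~~ odd #|triples e|.
Proof.
move=> em e0; apply: (@even_card_involution _ -%R) => [x|x|x]; first exact: opprK.
  have -> : (- x \in triples e) = (x \in triples e); last by [].
  have E1 : - x + 1 = - (x - 1) by ring.
  have E2 : - x - 1 = - (x + 1) by ring.
  rewrite !inE E1 E2 !chiN // -signr_odd (negPf em) !mul1r.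
  by do 3!case: (_ == e).
rewrite inE => /and3P[_ /eqP xe _]; move: e0; rewrite -xe.
apply: contra_neq => /eqP; rewrite -subr_eq0 -opprD oppr_eq0 -mulr2n -mulr_natl.
by rewrite mulf_eq0 (negPf (two_neq0 oddF)) => /eqP->; rewrite chi0.
Qed.

End Triples.

(** * A binomial coefficient prime to p *)

(** In base p the digits of n = (p^d - 1) / 4 are all (p - 1) / 4, so doubling n
    produces no carry. *)
Lemma divn_bin_carry p d n k : (1 < p)%N -> (p = 1 %[mod 4])%N -> (p ^ d = n.*2.*2.+1)%N ->
  (n.*2 %/ p ^ k = (n %/ p ^ k).*2)%N.
Proof.
move=> p_gt1 p1 pd.
have pow1 j : exists c, (p ^ j = c.*2.*2.+1)%N.
  exists (p ^ j %/ 4)%N; have : (p ^ j = 1 %[mod 4])%N.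
    by rewrite -modnXm p1 modnXm exp1n.
  by have := divn_eq (p ^ j) 4; lia.
have [kd|dk] := leqP k d.
  have [c pk] := pow1 k; have [c' pdk] := pow1 (d - k)%N.
  have nE : n = (c' * p ^ k + c)%N.
    by have := pd; rewrite -(subnK kd) expnD pdk pk; lia.
  have -> : n.*2 = (c'.*2 * p ^ k + c.*2)%N by rewrite nE; lia.
  by rewrite nE !divnMDl ?pk // !divn_small; lia.
have := ltn_exp2l d k p_gt1; rewrite dk pd => lt_n.
by rewrite !divn_small; lia.
Qed.
(** Legendre's formula: without carries, (2n)! and (n!)^2 have the same p-adic
    valuation. *)
Lemma ndvdn_bin_half p d n : prime p -> (p = 1 %[mod 4])%N ->
  (p ^ d = n.*2.*2.+1)%N -> ~~ (p %| 'C(n.*2, n))%N.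
Proof.
move=> p_pr p1 pd; have p_gt1 := prime_gt1 p_pr.
have le_n : (n <= n.*2)%N by lia.
have bin_gt : (0 < 'C(n.*2, n))%N by rewrite bin_gt0.
have logn_dbl : logn p (n.*2)`! = (logn p n`!).*2.
  rewrite !logn_fact // (@big_cat_nat _ _ _ n.+1) //= [X in (_ + X)%N]big1_seq; last first.
    move=> k /andP[_]; rewrite mem_index_iota => /andP[nk _].
    by rewrite (divn_bin_carry k p_gt1 p1 pd) divn_small // (leq_trans nk) // ltnW // ltn_expl.
  rewrite addn0 -[RHS]addnn -big_split /=; apply: eq_bigr => k _.
  by rewrite (divn_bin_carry k p_gt1 p1 pd) addnn.
have := congr1 (logn p) (bin_fact le_n).
have -> : (n.*2 - n)%N = n by lia.
rewrite !lognM ?muln_gt0 ?fact_gt0 // logn_dbl => log0.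
by apply/negP => /dvdn_leq_log; move/(_ p bin_gt); rewrite logn_prime // eqxx; lia.
Qed.

(** * The second moment of the cubic sums *)

Section SecondMoment.

Variable F : finFieldType.
Hypothesis oddF : odd #|F|.

Local Notation chi := (@quad_char F).
Local Notation m := (#|F|./2).
Local Notation S := (@cubic_sum F).

Lemma sum_neq0 : \sum_(x : F) (x != 0)%:R = #|F|%:R - 1 :> int.
Proof.
rewrite (bigD1 0) //= eqxx add0r (eq_bigr (fun=> 1)) => [|x ->] //.
by rewrite sumr_const cardC1 -[in RHS](ltn_predK (finNzRing_gt1 F)) -natr1 addrK.
Qed.

(** Substituting k x for x gives S(b k^2) = chi(k) S(b). *)
Lemma cubic_sum_sqr_class a b : a != 0 -> chi a = chi b -> S a ^+ 2 = S b ^+ 2.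
Proof.
move=> a0 ab.
have b0 : b != 0.
  by apply: contra_eq_neq ab => ->; case/orP: (chi_sign a0) => /eqP->; rewrite chi0.
have : ~~ nonsquare (a * b).
  by rewrite nonsquareE chiM // ab -expr2 chi_sqr.
rewrite negbK => /existsP[c /eqP abE].
pose k := c / b.
have aE : a = b * k ^+ 2.
  by rewrite /k expr_div_n -abE; field.
have k0 : k != 0 by apply: contra_neq a0 => k0; rewrite aE k0 expr0n mulr0.
have -> : S a = chi k * S b.
  rewrite /cubic_sum (reindex_inj (mulfI k0)) /= mulr_sumr; apply: eq_bigr => x _.
  have -> : k * x * ((k * x) ^+ 2 - a) = (k * k * k) * (x * (x ^+ 2 - b)).
    by rewrite aE; ring.
  by rewrite ![chi (k * k * k * _)]chiM // ![chi (_ * k)]chiM // -expr2 chi_sqr // mul1r.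
by rewrite exprMn chi_sqr // mul1r.
Qed.

Lemma cubic_sum0 : S 0 = 0.
Proof.
rewrite -[RHS](sum_chi oddF); apply: eq_bigr => x _.
have [->|x0] := eqVneq x 0; first by rewrite mul0r.
by rewrite subr0 !chiM // -expr2 chi_sqr // mulr1.
Qed.

Lemma sum_chi_pair (c e : F) :
  \sum_a chi ((c - a) * (e - a)) = (c == e)%:R * #|F|%:R - 1.
Proof.
have opp2 a : (c - a) * (e - a) = (a - c) * (a - e) by ring.
under eq_bigr do rewrite opp2.
have [->|ce] := eqVneq c e; last by rewrite sum_chi_quadratic // mul0r sub0r.
rewrite mul1r -sum_neq0 [RHS](reindex_inj (addIr (- e))) /=.
apply: eq_bigr => a _; have [->|ae] := eqVneq (a - e) 0; first by rewrite mul0r chi0.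
by rewrite chiM // -expr2 chi_sqr.
Qed.

(** Exchanging the sums leaves, for each x and y, the sum over a of
    chi((x^2 - a) (y^2 - a)); besides a multiple of the square of the sum of
    chi, only the pairs with y = x or y = -x contribute. *)
Lemma sum_sqr_cubic_sum : ~~ odd m ->
  \sum_a S a ^+ 2 = 2 * #|F|%:R * (#|F|%:R - 1).
Proof.
move=> em.
have N1 x : chi (- x) = chi x by rewrite chiN // -signr_odd (negPf em) mul1r.
transitivity (\sum_x \sum_y (chi x * chi y) * ((x ^+ 2 == y ^+ 2)%:R * #|F|%:R - 1)).
  rewrite /cubic_sum.
  under eq_bigr do rewrite expr2 big_distrlr /=.
  rewrite exchange_big; apply: eq_bigr => x _; rewrite exchange_big.
  apply: eq_bigr => y _; rewrite -sum_chi_pair mulr_sumr.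
  by apply: eq_bigr => a _; rewrite !chiM //; ring.
transitivity (\sum_x (2 * #|F|%:R * (x != 0)%:R - chi x * \sum_y chi y)).
  apply: eq_bigr => x _.
  under eq_bigr do rewrite mulrBr mulr1.
  rewrite sumrB -mulr_sumr; congr (_ - _).
  have [->|x0] := eqVneq x 0.
    by rewrite big1 ?mulr0 // => y _; rewrite chi0 !mul0r.
  rewrite (bigD1 x) // (bigD1 (- x)) /=; last first.
    rewrite -subr_eq0 -opprD oppr_eq0 -mulr2n -mulr_natl.
    by rewrite mulf_eq0 (negPf (two_neq0 oddF)).
  rewrite big1 => [|y /andP[yx yNx]].
    by rewrite sqrrN eqxx N1 -expr2 chi_sqr //=; ring.
  by rewrite eq_sym eqf_sqr (negPf yx) (negPf yNx) mul0r mulr0.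
rewrite sumrB -mulr_sumr sum_neq0 sum_chi // big1 ?subr0 // => x _.
by rewrite mulr0.
Qed.

(** S(a)^2 equals S(1)^2 on the non-zero squares and S(g)^2 on the non-squares,
    so the second moment is (q - 1) / 2 times their sum. *)
Lemma cubic_sum_two_squares g : ~~ odd m -> chi g = -1 ->
  S 1 ^+ 2 + S g ^+ 2 = 4 * #|F|%:R.
Proof.
move=> em g1.
have : 2 * \sum_a S a ^+ 2 = (#|F|%:R - 1) * (S 1 ^+ 2 + S g ^+ 2).
  (* twice the indicators of the two classes, which avoids counting them *)
  transitivity (\sum_a (((a != 0)%:R + chi a) * S 1 ^+ 2
                        + ((a != 0)%:R - chi a) * S g ^+ 2)).
    rewrite mulr_sumr; apply: eq_bigr => a _.
    have [->|a0] := eqVneq a 0; first by rewrite cubic_sum0 chi0 /=; ring.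
    case/orP: (chi_sign a0) => /eqP a1.
      by rewrite (@cubic_sum_sqr_class _ 1) // ?a1 ?chi1 //=; ring.
    by rewrite (@cubic_sum_sqr_class _ g) // ?a1 ?g1 //=; ring.
  rewrite big_split /= -!mulr_suml sumrB big_split /= sum_neq0 sum_chi //.
  by ring.
rewrite sum_sqr_cubic_sum //.
have q1 : (#|F|%:R - 1 : int) != 0.
  by rewrite subr_eq0 pnatr_eq1 gtn_eqF ?finNzRing_gt1.
by move=> H; apply: (mulfI q1); rewrite -H; ring.
Qed.

(** * The cubic sum modulo p *)

(** With z a generator, multiplication by z permutes F and scales the sum by
    z^k, which is not 1. *)
Lemma sum_expr_ndvd k : ~~ (m.*2 %| k)%N -> \sum_(x : F) x ^+ k = 0.
Proof.
have [z pz] := exists_generator oddF.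
rewrite (prim_order_dvd pz) => zk.
have z0 := generator_neq0 oddF pz.
have : (z ^+ k - 1) * \sum_(x : F) x ^+ k = 0.
  rewrite mulrBl mul1r [in X in _ - X](reindex_inj (mulfI z0)) /= mulr_sumr.
  by apply/eqP; rewrite subr_eq0; apply/eqP/eq_bigr => x _; rewrite exprMn.
by move/eqP; rewrite mulf_eq0 subr_eq0 (negPf zk) => /eqP.
Qed.

Lemma sum_expr_order : \sum_(x : F) x ^+ m.*2 = -1.
Proof.
rewrite (bigD1 0) //= expr0n double_eq0 gtn_eqF ?card_half_gt0 //= add0r.
rewrite (eq_bigr (fun=> 1)) => [|x x0]; last by rewrite unit_expr.
rewrite sumr_const cardC1.
have : 1 *+ #|F| = 0 :> F.
  have : \sum_(x : F) (x + 1) = \sum_(x : F) x by rewrite [RHS](reindex_inj (addIr 1)).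
  by rewrite big_split /= sumr_const -[RHS]addr0 => /addrI.
rewrite -(ltn_predK (finNzRing_gt1 F)) mulrSr => /eqP.
by rewrite addr_eq0 => /eqP.
Qed.

(** By Euler's criterion the summand is (x^3 - x)^(2 l).  Its monomials have
    degrees between 2 l and 6 l, and only the degree q - 1 = 4 l gives a
    non-zero power sum. *)
Lemma cubic_sum_modp l : #|F| = l.*2.*2.+1 ->
  (S 1)%:~R = - ((-1) ^+ l * 'C(l.*2, l)%:R) :> F.
Proof.
move=> qE; have mE : m = l.*2 by rewrite qE; lia.
rewrite /cubic_sum rmorph_sum /=.
transitivity (\sum_(i < l.*2.+1) ((-1) ^+ i * 'C(l.*2, i)%:R) *
                \sum_(x : F) x ^+ (l.*2 + (l.*2 - i).*2)).
  under [RHS]eq_bigr do rewrite mulr_sumr.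
  rewrite exchange_big /=; apply: eq_bigr => x _.
  rewrite euler_criterion // mE exprMn exprDn mulr_sumr; apply: eq_bigr => i _.
  by rewrite exprD -[(_ - i).*2]mul2n exprM -mulr_natr; ring.
have lm : (l < l.*2.+1)%N by lia.
rewrite (bigD1 (Ordinal lm)) //= [X in _ + X]big1 ?addr0 => [|i il].
  have -> : (l.*2 + (l.*2 - l).*2)%N = l.*2.*2 by lia.
  by have := sum_expr_order; rewrite mE => ->; rewrite mulrN1.
rewrite sum_expr_ndvd ?mulr0 // mE.
apply/dvdnP => -[k kE].
have {}il : nat_of_ord i <> l by move=> E; case/eqP: il; apply: val_inj.
have l0 : (0 < l)%N by move: (card_half_gt0 oddF); rewrite mE double_gt0.
have := ltn_ord i.
case: k kE => [|[|k]]; nia.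
Qed.

End SecondMoment.

(** * The counts in terms of the cubic sum *)

Section Evaluation.

Variable F : finFieldType.
Hypothesis oddF : odd #|F|.

Local Notation chi := (@quad_char F).
Local Notation m := (#|F|./2).
Local Notation S := (@cubic_sum F).
Local Notation q := (#|F|%:R : int).

Lemma counts_half_odd : odd m ->
  8 * (Mcount F)%:R = q - 5 - 2 * chi 2 /\ 8 * (Ncount F)%:R = q - 5 - 2 * chi 2.
Proof.
move=> om; rewrite McountE NcountE !card_triples // !cubic_sum_eq0 // !chiN // chi1 //.
by rewrite -signr_odd om; split; ring.
Qed.

Lemma counts_half_even : ~~ odd m ->
  8 * (Mcount F)%:R = q + S 1 - 11 - 4 * chi 2 /\ 8 * (Ncount F)%:R = q - S 1 - 3.
Proof.
move=> em; rewrite McountE NcountE !card_triples // !chiN // chi1 //.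
by rewrite -signr_odd (negPf em); split; ring.
Qed.

Lemma even_counts : ~~ odd m -> ~~ odd (Mcount F) /\ ~~ odd (Ncount F).
Proof. by move=> em; rewrite McountE NcountE !even_card_triples. Qed.

(** S(1) is even because 8 N = q - S(1) - 3 with q odd; then S(g) is even too,
    since its square is a multiple of 4. *)
Lemma half_cubic_sum : ~~ odd m ->
  exists a b : int, S 1 = 2 * a /\ q = a ^+ 2 + b ^+ 2.
Proof.
move=> em; have [g g1] := exists_nonsquare oddF.
have := cubic_sum_two_squares oddF em g1.
have [_] := counts_half_even em.
move: (S 1) (S g) (Ncount F) (oddF) => A B N; move: #|F| => n on NE AB.
have [a aE] : exists a, A = 2 * a.
  exists (n./2%:R - 1 - 4 * N%:R); have := odd_double_half n; rewrite on; lia.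
have [b bE] : exists b, B = 2 * b.
  exists (B %/ 2)%Z; have : ~~ (2 %| B)%Z -> False; last by lia.
  move=> B2; have BE : B = 2 * (B %/ 2)%Z + 1 by lia.
  by move: AB; rewrite aE BE; lia.
by exists a, b; split => //; move: AB; rewrite aE bE; lia.
Qed.

End Evaluation.

(** * Representations of a prime power as a sum of two squares *)

Lemma odd_sqr_sum (n : nat) (s u : int) : odd n ->
  (s = 1 %[mod 4])%Z -> (u = 1 %[mod 4])%Z -> s ^+ 2 + u ^+ 2 <> n%:Z.
Proof.
move=> n_odd s1 u1.
have [s' ->] : exists s', s = 2 * s' + 1 by exists (s %/ 2)%Z; lia.
have [u' ->] : exists u', u = 2 * u' + 1 by exists (u %/ 2)%Z; lia.
have -> : (2 * s' + 1) ^+ 2 + (2 * u' + 1) ^+ 2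
        = 2 * (2 * (s' ^+ 2 + s' + u' ^+ 2 + u') + 1) by ring.
by move: (_ + 1) => k; move: n_odd; clear; lia.
Qed.

(** With q = p^d, the product (s u - t v) (s u + t v) is a multiple of q, and p
    cannot divide both factors because their sum is 2 s u; so q divides one of
    them, the first after changing the sign of v if necessary.  In the identity
    (s u - t v)^2 + (s v + t u)^2 = q^2 one term must then be 0.  The first can
    be 0 only if s^2 + u^2 = q, impossible by parity; the second only if
    s^2 = u^2, and the residues mod 4 then exclude s = - u. *)
Lemma two_squares_unique (p d : nat) (s t u v : int) :
  prime p -> odd p -> (p ^ d)%:Z = s ^+ 2 + t ^+ 2 -> (p ^ d)%:Z = u ^+ 2 + v ^+ 2 ->
  ~~ (p%:Z %| s)%Z -> ~~ (p%:Z %| u)%Z -> (s = 1 %[mod 4])%Z -> (u = 1 %[mod 4])%Z ->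
  s = u.
Proof.
move=> p_pr p_odd qst quv ps pu s1 u1.
have q_odd : odd (p ^ d)%N by rewrite oddX p_odd orbT.
have p_mul (x y : int) : (p%:Z %| x * y)%Z = (p%:Z %| x)%Z || (p%:Z %| y)%Z.
  by rewrite !dvdzE abszM Euclid_dvdM.
have q_gauss (x y : int) : ~~ (p%:Z %| x)%Z -> ((p ^ d)%:Z %| x * y)%Z -> ((p ^ d)%:Z %| y)%Z.
  move=> px; rewrite Gauss_dvdzr // coprimezE /=.
  by apply: coprimeXl; rewrite prime_coprime // -dvdzE.
move: (p ^ d)%N q_odd qst quv q_gauss => q q_odd qst quv q_gauss.
have q_neq0 : q%:Z != 0 by case: (q) q_odd.
have prodE (w : int) : q%:Z = u ^+ 2 + w ^+ 2 ->
    (s * u - t * w) * (s * u + t * w) = q%:Z * (s ^+ 2 + u ^+ 2 - q%:Z).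
  move=> quw.
  transitivity (s ^+ 2 * (u ^+ 2 + w ^+ 2) + u ^+ 2 * (s ^+ 2 + t ^+ 2)
                - (s ^+ 2 + t ^+ 2) * (u ^+ 2 + w ^+ 2)); first by ring.
  by rewrite -qst -quw; ring.
have key (w : int) : q%:Z = u ^+ 2 + w ^+ 2 -> (q%:Z %| s * u - t * w)%Z -> s = u.
  move=> quw /dvdzP[k kE].
  have kZ : k ^+ 2 * q%:Z ^+ 2 + (s * w + t * u) ^+ 2 = q%:Z ^+ 2.
    transitivity ((s ^+ 2 + t ^+ 2) * (u ^+ 2 + w ^+ 2)).
      by rewrite -exprMn -kE; ring.
    by rewrite -qst -quw.
  have k2 : (k ^+ 2 == 0) || (k ^+ 2 == 1).
    have : k ^+ 2 * q%:Z ^+ 2 <= 1 * q%:Z ^+ 2.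
      by rewrite mul1r -[X in _ <= X]kZ lerDl sqr_ge0.
    rewrite ler_pM2r ?exprn_even_gt0 //; have := sqr_ge0 k; lia.
  case/orP: k2 => /eqP k2.
    have : q%:Z * (s ^+ 2 + u ^+ 2 - q%:Z) = 0.
      rewrite -(prodE w quw).
      by move/eqP: k2; rewrite expf_eq0 /= => /eqP k0; rewrite kE k0; ring.
    move/eqP; rewrite mulf_eq0 (negPf q_neq0) /= subr_eq0 => /eqP.
    by move=> su; case: (odd_sqr_sum q_odd s1 u1 su).
  have Z0 : (s * w + t * u) ^+ 2 = 0.
    by apply: (addrI (q%:Z ^+ 2)); rewrite -[X in X + _]mul1r -k2 kZ addr0.
  have : q%:Z * (s ^+ 2 - u ^+ 2) = 0.
    transitivity (s ^+ 2 * (u ^+ 2 + w ^+ 2) - (s ^+ 2 + t ^+ 2) * u ^+ 2).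
      by rewrite -qst -quw; ring.
    transitivity ((s * w + t * u) * (s * w - t * u)); first by ring.
    by move/eqP: Z0; rewrite expf_eq0 /= => /eqP ->; rewrite mul0r.
  move/eqP; rewrite mulf_eq0 (negPf q_neq0) /= subr_eq0 eqf_sqr => /orP[/eqP //|/eqP sE].
  by move: s1 u1; rewrite sE; clear; lia.
have q_dvd : (q%:Z %| (s * u - t * v) * (s * u + t * v))%Z by rewrite (prodE v) // dvdz_mulr.
have [pX|pX] := boolP (p%:Z %| s * u - t * v)%Z; last first.
  apply: (key (- v)); first by rewrite sqrrN.
  by rewrite mulrN opprK; apply: q_gauss q_dvd.
have [pY|pY] := boolP (p%:Z %| s * u + t * v)%Z; last first.
  by apply: (key v) => //; apply: (q_gauss _ _ pY); rewrite mulrC.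
have : (p%:Z %| 2 * (s * u))%Z.
  have -> : 2 * (s * u) = (s * u - t * v) + (s * u + t * v) by ring.
  by rewrite rpredD.
rewrite !p_mul (negPf ps) (negPf pu) !orbF dvdzE /= => p2.
by move: (dvdn_leq (isT : (0 < 2)%N) p2) (prime_gt1 p_pr) p_odd; clear; lia.
Qed.

(** The order of the prime field is 3 mod 4, so there -1 is a non-square and
    cannot be the quotient of two non-zero squares. *)
Lemma dvdz_sum_squares (p : nat) (a b : int) : prime p -> (p = 3 %[mod 4])%N ->
  (p%:Z %| a ^+ 2 + b ^+ 2)%Z -> (p%:Z %| a)%Z && (p%:Z %| b)%Z.
Proof.
move=> p_pr p3; have chp := pchar_Fp p_pr.
have oddFp : odd #|'F_p| by rewrite card_Fp //; lia.
have om : odd (#|'F_p|./2) by rewrite card_Fp //; lia.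
have dvdE (x : int) : (p%:Z %| x)%Z = (x%:~R == 0 :> 'F_p) by rewrite (dvdz_pcharf chp).
rewrite !dvdE rmorphD !rmorphXn /=; move: a%:~R b%:~R => {}a {}b ab0.
have sq_ge0 (x : 'F_p) : 0 <= quad_char (x ^+ 2) by rewrite chiM // -expr2 sqr_ge0.
have a0 : a == 0.
  apply/negPn/negP => a0; have := sq_ge0 b.
  have -> : b ^+ 2 = - (a ^+ 2) by apply/eqP; rewrite -addr_eq0 addrC.
  by rewrite chiN // -signr_odd om chiM // -expr2 chi_sqr.
by move: ab0; rewrite (eqP a0) eqxx expr0n add0r expf_eq0.
Qed.

Lemma two_squares_3mod4 (p e : nat) (a b : int) : prime p -> (p = 3 %[mod 4])%N ->
  a ^+ 2 + b ^+ 2 = (p ^ e)%:Z ^+ 2 -> a = 0 \/ b = 0.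
Proof.
move=> p_pr p3; elim: e a b => [|e IH] a b abE.
  by nia.
have p0 : p%:Z != 0 by case: (p) p_pr.
have : (p%:Z %| a ^+ 2 + b ^+ 2)%Z.
  by rewrite abE expnS PoszM exprMn expr2 -!mulrA dvdz_mulr.
case/(dvdz_sum_squares p_pr p3)/andP => /dvdzP[a' aE] /dvdzP[b' bE].
have /IH[a0|b0] : a' ^+ 2 + b' ^+ 2 = (p ^ e)%:Z ^+ 2.
  apply: (mulIf (expf_neq0 2 p0)); move: abE.
  by rewrite aE bE expnS PoszM => abE; rewrite mulrDl -!exprMn abE; ring.
- by left; rewrite aE a0 mul0r.
- by right; rewrite bE b0 mul0r.
Qed.

(** * Evaluation of the counts *)

Lemma count_algC (n : nat) (z : int) : 8 * n%:R = z -> n%:R = z%:~R / 8 :> algC.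
Proof.
move=> <-; rewrite rmorphM /= !rmorph_nat mulrC mulKf //; last by rewrite pnatr_eq0.
Qed.

Section Counts.

Variable F : finFieldType.
Hypothesis oddF : odd #|F|.

Lemma chi_two_3mod4 : (#|F| %% 4 = 3)%N ->
  quad_char (2 : F) = if (#|F| %% 8 == 7)%N then 1 else -1.
Proof.
move=> q4; have om : odd (#|F|./2) by lia.
have [ME _] := counts_half_odd oddF om.
move: (chi_sign (two_neq0 oddF)) ME q4; move: (quad_char _) (Mcount F) => c M.
by move: #|F| => q /orP[]/eqP-> ME q4; case: ifP => q8; lia.
Qed.

(** Divisibility of the counts by 2 is essential: adding the two formulas and
    reducing mod 8 alone leaves both signs possible. *)
Lemma chi_two_1mod4 : (#|F| %% 4 = 1)%N ->
  quad_char (2 : F) = if (#|F| %% 8 == 1)%N then 1 else -1.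
Proof.
move=> q4; have em : ~~ odd (#|F|./2) by lia.
have [ME NE] := counts_half_even oddF em; have [Mev Nev] := even_counts oddF em.
move: (chi_sign (two_neq0 oddF)) ME NE Mev Nev q4.
move: (quad_char _) (Mcount F) (Ncount F) (cubic_sum _) => c M N S.
by move: #|F| => q /orP[]/eqP-> ME NE Mev Nev q4; case: ifP => q8; lia.
Qed.

Lemma counts_3mod4 : (#|F| %% 4 = 3)%N ->
  8 * (Mcount F)%:R = #|F|%:R - (if (#|F| %% 8 == 7)%N then 7 else 3) :> int
  /\ Ncount F = Mcount F.
Proof.
move=> q4; have om : odd (#|F|./2) by lia.
have [ME NE] := counts_half_odd oddF om; move: ME NE; rewrite chi_two_3mod4 //.
by case: ifP => _ ME NE; lia.
Qed.

(** The congruence s = 1 mod 4 restates that the first count is an integer. *)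
Lemma counts_1mod4 : (#|F| %% 4 = 1)%N ->
  exists s t : int,
  [/\ #|F|%:Z = s ^+ 2 + t ^+ 2, (s = 1 %[mod 4])%Z,
      cubic_sum (1 : F) = 2 * s \/ cubic_sum (1 : F) = 2 * - s
    & if (#|F| %% 8 == 1)%N
      then 8 * (Mcount F)%:R = #|F|%:R - 2 * s - 15 /\
           8 * (Ncount F)%:R = #|F|%:R + 2 * s - 3
      else 8 * (Mcount F)%:R = #|F|%:R + 2 * s - 7 /\
           8 * (Ncount F)%:R = #|F|%:R - 2 * s - 3].
Proof.
move=> q4; have em : ~~ odd (#|F|./2) by lia.
have [a [b [Sa qab]]] := half_cubic_sum oddF em.
have [ME NE] := counts_half_even oddF em; move: ME NE; rewrite chi_two_1mod4 // Sa.
case: ifP => q8 ME NE.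
  exists (- a), b; split; [by rewrite sqrrN -qab natz| lia | by right; rewrite opprK | lia].
exists a, b; split; [by rewrite -qab natz| lia | by left | lia].
Qed.

Lemma cubic_sum_ndvd p d : prime p -> (p = 1 %[mod 4])%N -> #|F| = (p ^ d)%N ->
  ~~ (p%:Z %| cubic_sum (1%R : F))%Z.
Proof.
move=> p_pr p1 qE; have pF := card_finPcharP qE p_pr.
have q4 : (#|F| %% 4 = 1)%N by rewrite qE -modnXm p1 modnXm exp1n.
pose l := (#|F| %/ 4)%N.
have lE : #|F| = l.*2.*2.+1 by rewrite /l; lia.
rewrite (dvdz_pcharf pF) (cubic_sum_modp oddF lE) oppr_eq0 mulf_eq0 signr_eq0 /=.
by rewrite -(dvdn_pcharf pF) (ndvdn_bin_half p_pr p1 (d := d)) // -qE.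
Qed.

End Counts.

Lemma sqrtC_nat_sqr (n : nat) : sqrtC ((n ^ 2)%N%:R : algC) = n%:R.
Proof. by rewrite natrX sqrCK ?ler0n. Qed.

(** For odd q = 1 mod 4 this leaves only even exponents of p = 3 mod 4, hence
    q = 1 mod 8. *)
Lemma expn_3mod4 (p d : nat) : (p = 3 %[mod 4])%N ->
  if odd d then (p ^ d = 3 %[mod 4])%N else (p ^ d = 1 %[mod 8])%N.
Proof.
move=> p3; have sq8 k : ((p ^ 2) ^ k = 1 %[mod 8])%N.
  rewrite -modnXm (_ : p ^ 2 = 1 %[mod 8])%N ?modnXm ?exp1n //.
  have -> : p = (4 * (p %/ 4) + 3)%N by lia.
  by move: (p %/ 4)%N => c; rewrite -mulnn; lia.
rewrite -{2 3}[d]odd_double_half -mul2n expnD expnM; move: (sq8 d./2).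
by case: (odd d); rewrite ?expn1 ?mul1n //; move: (_ ^ _)%N => y; lia.
Qed.

Theorem theorem1p1 (p d q : nat) (F : finFieldType)
    (p_prime : prime p) (p_odd : odd p) (d_ge1 : (1 <= d)%N)
    (q_def : q = (p ^ d)%N) (card_F : #|F| = q) :
  [/\ (* Case 1 *)
      (q = 7 %[mod 8])%N ->
        (Mcount F)%:R = (q%:R - 7) / 8 :> algC /\
        (Ncount F)%:R = (q%:R - 7) / 8 :> algC,
      (* Case 2 *)
      (q = 3 %[mod 8])%N ->
        (Mcount F)%:R = (q%:R - 3) / 8 :> algC /\
        (Ncount F)%:R = (q%:R - 3) / 8 :> algC,
      (* Case 3 *)
      (q = 5 %[mod 8])%N ->
        (exists! s : int, two_squares_part p q s) /\
        (forall s : int, two_squares_part p q s ->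
           (Mcount F)%:R = (q%:R + 2 * s%:~R - 7) / 8 :> algC /\
           (Ncount F)%:R = (q%:R - 2 * s%:~R - 3) / 8 :> algC),
      (* Case 4 *)
      (q = 1 %[mod 8])%N -> (p = 1 %[mod 4])%N ->
        (exists! s : int, two_squares_part p q s) /\
        (forall s : int, two_squares_part p q s ->
           (Mcount F)%:R = (q%:R - 2 * s%:~R - 15) / 8 :> algC /\
           (Ncount F)%:R = (q%:R + 2 * s%:~R - 3) / 8 :> algC)
    & (* Case 5 *)
      (q = 1 %[mod 8])%N -> (p = 3 %[mod 4])%N ->
        [/\ exists r : nat, q = (r ^ 2)%N,
            (Mcount F)%:R =
              8^-1 * (q%:R - 2 * (-1) ^+ (d %/ 2) * sqrtC q%:R - 15) :> algC
          & (Ncount F)%:R =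
              8^-1 * (q%:R + 2 * (-1) ^+ (d %/ 2) * sqrtC q%:R - 3) :> algC]].
Proof.
have oddF : odd #|F| by rewrite card_F q_def oddX p_odd orbT.
have pow4 j : (p ^ j = (p %% 4) ^ j %[mod 4])%N by rewrite modnXm.
have c3 := counts_3mod4 oddF; have c1 := counts_1mod4 oddF.
rewrite card_F in c3 c1.
have unique_s : (p = 1 %[mod 4])%N -> exists s : int,
    [/\ two_squares_part p q s, forall u, two_squares_part p q u -> s = u
    & if (q %% 8 == 1)%N
      then 8 * (Mcount F)%:R = q%:R - 2 * s - 15 /\
           8 * (Ncount F)%:R = q%:R + 2 * s - 3
      else 8 * (Mcount F)%:R = q%:R + 2 * s - 7 /\
           8 * (Ncount F)%:R = q%:R - 2 * s - 3].
  move=> p1; have q4 : (q %% 4 = 1)%N by rewrite q_def pow4 p1 modnXm exp1n.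
  have [s [t [qst s1 Ss cnt]]] := c1 q4.
  have ps : ~~ (p%:Z %| s)%Z.
    have := cubic_sum_ndvd oddF p_prime p1 (etrans card_F q_def).
    by apply: contra => ps; case: Ss => ->; rewrite dvdz_mull ?rpredN.
  exists s; split=> //; first by split=> //; exists t.
  move=> u [[v quv] pu u1].
  by apply: (@two_squares_unique p d s t u v); rewrite -?q_def.
split.
- move=> q8; have [|ME ->] := c3; first by lia.
  move: ME; rewrite (_ : (q %% 8 == 7)%N) ?q8 // => /count_algC.
  by rewrite rmorphB /= !rmorph_nat.
- move=> q8; have [|ME ->] := c3; first by lia.
  move: ME; rewrite (_ : (q %% 8 == 7)%N = false) ?q8 // => /count_algC.
  by rewrite rmorphB /= !rmorph_nat.
- move=> q8.
  have p1 : (p = 1 %[mod 4])%N.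
    have [//|p3] : (p = 1 %[mod 4])%N \/ (p = 3 %[mod 4])%N by move: p_odd; clear; lia.
    by have := expn_3mod4 d p3; rewrite -q_def; case: ifP => _; move: q8; clear; lia.
  have [s [sP s_uniq]] := unique_s p1.
  rewrite (_ : (q %% 8 == 1)%N = false) ?q8 // => -[/count_algC ME /count_algC NE].
  split; first by exists s.
  move=> u /s_uniq <-; rewrite ME NE.
  by rewrite !(rmorphB, rmorphD, rmorphM) /= !rmorph_nat.
- move=> q8 p1; have [s [sP s_uniq]] := unique_s p1.
  rewrite (_ : (q %% 8 == 1)%N) ?q8 // => -[/count_algC ME /count_algC NE].
  split; first by exists s.
  move=> u /s_uniq <-; rewrite ME NE.
  by rewrite !(rmorphB, rmorphD, rmorphM) /= !rmorph_nat.
move=> q8 p3.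
have d_even : ~~ odd d.
  apply/negP => d_odd; have := expn_3mod4 d p3; rewrite d_odd -q_def.
  by move: q8; clear; lia.
have qE : q = ((p ^ (d %/ 2)) ^ 2)%N.
  by rewrite q_def -expnM divn2 muln2 even_halfK.
have q4 : (q %% 4 = 1)%N by lia.
have [s [t [qst s1 _]]] := c1 q4.
rewrite (_ : (q %% 8 == 1)%N) ?q8 // => -[ME NE].
have qZ : q%:Z = (p ^ (d %/ 2))%:Z ^+ 2 by rewrite qE -mulnn PoszM.
(* both sides are square roots of q congruent to 1 mod 4 *)
have sE : s = (-1) ^+ (d %/ 2) * (p ^ (d %/ 2))%:Z.
  have [|s0|t0] := @two_squares_3mod4 p (d %/ 2) s t p_prime p3.
  - by rewrite -qst.
  - by move: s1; rewrite s0.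
  have : s ^+ 2 = (p ^ (d %/ 2))%:Z ^+ 2.
    by move: qst; rewrite t0 expr0n addr0 => <-.
  have := expn_3mod4 (d %/ 2) p3; rewrite -signr_odd.
  by move=> pe /eqP; rewrite eqf_sqr => /orP[]/eqP sE; move: pe s1; rewrite sE;
     case: (odd _) => pe s1; rewrite ?(expr0, expr1, mul1r, mulN1r) //; move: pe s1; clear; lia.
have sqrt_q : sqrtC q%:R = (p ^ (d %/ 2))%:R :> algC by rewrite qE sqrtC_nat_sqr.
split; first by exists (p ^ (d %/ 2))%N.
  rewrite (count_algC ME) sqrt_q mulrC sE.
  by rewrite !(rmorphB, rmorphD, rmorphM, rmorphXn, rmorphN1) /= !rmorph_nat mulrA.
rewrite (count_algC NE) sqrt_q mulrC sE.
by rewrite !(rmorphB, rmorphD, rmorphM, rmorphXn, rmorphN1) /= !rmorph_nat mulrA.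
Qed.
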